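(* Let $c\in\mathbb{R}^m$ and let $T_c:\mathbb{R}^m\to\mathbb{R}^m$ be the linear map which is the identity if $c=0$, and, if $c\neq0$, sends $c\mapsto\lambda(\|c\|)\,c$ and is the identity on $c^\perp$. Then $$b_\infty\, T_c\left(\frac{1}{\sqrt{2\pi}}B_m\right)\subset G(c)\subset T_c\left(\frac{1}{\sqrt{2\pi}}B_m\right),$$ where $B_m$ is the unit ball of $\mathbb{R}^m$ and $b_\infty:=\min\{\varphi_\infty(\cos t,\sin t): t\in[0,2\pi]\}\approx 0.91$.
   Context: For an integrable random vector $X\in\mathbb{R}^m$, the Vitale zonoid $\mathbb{E}\underline{X}$ is the convex body with support function $h(u)=\frac12\mathbb{E}|\langle u,X\rangle|$ (where $h_K(u)=\sup_{x\in K}\langle u,x\rangle$). For $c\in\mathbb{R}^m$, $G(c):=\mathbb{E}\underline{c+\xi}$ with $\xi\in\mathbb{R}^m$ a standard Gaussian vector. $\operatorname{erf}(t)=\frac{2}{\sqrt\pi}\int_0^te^{-s^2}ds$. The function $\lambda:\mathbb{R}\to\mathbb{R}$ is $\lambda(s)=e^{-s^2/2}+\sqrt{\pi/2}\,s\,\operatorname{erf}(s/\sqrt2)$, and $\varphi_\infty:\mathbb{R}^2\to\mathbb{R}$ is $\varphi_\infty(x,z)=|z|e^{-x^2/(\pi z^2)}+x\operatorname{erf}\left(\frac{x}{\sqrt\pi|z|}\right)$ (extended by continuity at $z=0$, where it equals $|x|$). *)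

(* Defs.v *)
From HB Require Import structures.
From mathcomp Require Import all_boot all_order all_algebra.
From mathcomp Require Import all_classical all_reals all_analysis.
Set Implicit Arguments. Unset Strict Implicit. Unset Printing Implicit Defensive.
Import Order.TTheory GRing.Theory Num.Theory.
Local Open Scope classical_set_scope.
Local Open Scope ring_scope.

Section Defs.
Variable R : realType.

Definition dotv m (u x : 'rV[R]_m) : R := \sum_i u ord0 i * x ord0 i.
Definition normv m (x : 'rV[R]_m) : R := Num.sqrt (dotv x x).

(* E f(xi) for xi a standard Gaussian vector in R^n, for nonnegative
   (extended-real valued) f: iterated integral against the product of
   n standard normal laws (coordinates are independent N(0,1)). *)
Fixpoint gaussE (n : nat) : ('rV[R]_n -> \bar R) -> \bar R :=
  match n with
  | 0 => fun f => f 0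
  | n'.+1 => fun f =>
      (\int[normal_prob (0:R) 1]_x
         gaussE (fun v : 'rV[R]_n' => f (row_mx (const_mx x : 'rV[R]_1) v)))%E
  end.

(* support function of the Vitale zonoid G(c) *)
Definition hG m (c : 'rV[R]_m) (u : 'rV[R]_m) : \bar R :=
  ((2^-1)%:E * gaussE (fun xi : 'rV[R]_m => (`|dotv u (c + xi)|)%:E))%E.

(* G(c): the convex body whose support function is hG c *)
Definition G m (c : 'rV[R]_m) : set 'rV[R]_m :=
  [set x | forall u, ((dotv u x)%:E <= hG c u)%E].

Definition erf (t : R) : R :=
  2 / Num.sqrt pi *
  (if 0 <= t then Rintegral lebesgue_measure `[0, t] (fun s => expR (- s ^+ 2))
   else - Rintegral lebesgue_measure `[t, 0] (fun s => expR (- s ^+ 2))).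

Definition lambda (s : R) : R :=
  expR (- s ^+ 2 / 2) + Num.sqrt (pi / 2) * s * erf (s / Num.sqrt 2).

Definition phi_inf (x z : R) : R :=
  if z == 0 then `|x|
  else `|z| * expR (- x ^+ 2 / (pi * z ^+ 2)) + x * erf (x / (Num.sqrt pi * `|z|)).

Definition b_inf : R :=
  inf [set phi_inf (cos t) (sin t) | t in `[0, pi *+ 2]].

Definition Tc m (c : 'rV[R]_m) (y : 'rV[R]_m) : 'rV[R]_m :=
  if c == 0 then y
  else y + ((lambda (normv c) - 1) * dotv y c / normv c ^+ 2) *: c.

Definition ballR m (r : R) : set 'rV[R]_m := [set y | normv y <= r].

End Defs.

(* Main.v *)
(** A linear form of a Gaussian vector is Gaussian, so the support function of
    [G c] at [u] is [r |u| lambda (<u, c> / |u|)] with [r = 1 / sqrt (2 pi)],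
    while the ellipsoid [T_c (r B)] has support function [r |T_c u|], where
      [|T_c u|^2 = |u|^2 (1 + (lambda |c| ^2 - 1) (s / |c|)^2)],
      [s = <u, c> / |u|].
    The upper inclusion therefore reduces to the fact that [(lambda x ^2 - 1) / x ^2] is
    nondecreasing for [x > 0], which follows by differentiating. As this ratio
    tends to [pi / 2], [|T_c u|^2 <= |u|^2 (1 + pi / 2 s^2)], and
    [lambda s / sqrt (1 + pi / 2 s^2)] is a value of [phi_inf] on the unit
    circle, hence at least [b_inf]. Since [T_c] is symmetric and invertible,
    these inequalities between support functions give the inclusions. *)

Require Import Defs.
From HB Require Import structures.
From mathcomp Require Import all_boot all_order all_algebra.
From mathcomp Require Import all_classical all_reals all_analysis.
From mathcomp Require Import measurable_realfun ring.
Import Order.TTheory GRing.Theory Num.Theory.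
Import numFieldNormedType.Exports.
Local Open Scope classical_set_scope.
Local Open Scope ring_scope.
Set Implicit Arguments. Unset Strict Implicit. Unset Printing Implicit Defensive.

(** The derivative is passed as an explicit function, so that each monotonicity proof below reduces
    to a derivative computation and a sign. *)
Lemma nondecreasing_is_derive (R : realType) (f df : R -> R) (a : R) :
  (forall x : R, a <= x -> is_derive x 1 f (df x)) ->
  (forall x, a <= x -> 0 <= df x) ->
  forall x y, a <= x -> x <= y -> f x <= f y.
Proof.
move=> f' df0; apply: ger0_derive1_ndecry => [x|x|].
- by rewrite in_itv/= andbT => /ltW/f' f'x; exact: ex_derive.
- rewrite in_itv/= andbT derive1E => /ltW ax.
  by have f'x := f' x ax; rewrite derive_val; exact: df0.
- apply: continuous_in_subspaceT => x /[!inE]/=; rewrite in_itv/= andbT => ax.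
  have f'x := f' x ax.
  exact/differentiable_continuous/derivable1_diffP/ex_derive.
Qed.

(** * The error function *)

Section erf_theory.
Variable R : realType.
Implicit Types t x s : R.
Let mu := @lebesgue_measure R.

Lemma integrable_gauss (A : set (measurableTypeR R)) : measurable A ->
  mu.-integrable A (EFin \o @gauss_fun R).
Proof.
by move=> mA; apply: (integrableS measurableT mA) integrableT_gauss => //.
Qed.

(** Integrating from minus infinity gives one formula for both signs of [t], to which the
    fundamental theorem of calculus applies at once. *)
Let F t := (\int[mu]_(x in `]-oo, t]) gauss_fun x)%R.

Lemma is_derive_gauss_tail t : is_derive t 1 F (gauss_fun t).
Proof.
have tt1 : t < t + 1 by rewrite ltrDl.
have int1 : mu.-integrable `]-oo, (t + 1)] (EFin \o @gauss_fun R).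
  exact: integrable_gauss.
have [] := @continuous_FTC1 R (@gauss_fun R) -oo%O t (t + 1) tt1 int1.
  by rewrite ltNye_eq.
  exact: continuous_gauss_fun.
move=> dF <-; rewrite derive1E; exact: derivableP.
Qed.

Lemma erfE t : erf t = 2 / Num.sqrt pi * (F t - F 0).
Proof.
rewrite /erf; congr (_ * _).
have B a b : a <= b -> F b - F a = (\int[mu]_(x in `[a, b]) gauss_fun x)%R.
  by move=> ab; rewrite /F Rintegral_itvB ?bnd_simp ?Rintegral_itv_obnd_cbnd//;
    exact: integrable_gauss.
by case: leP => [t0|/ltW t0]; rewrite -B// opprB.
Qed.

Lemma is_derive_erf t :
  is_derive t 1 (@erf R) (2 / Num.sqrt pi * expR (- t ^+ 2)).
Proof.
have -> : @erf R = (2 / Num.sqrt pi) \*: (F - cst (F 0)).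
  by apply/funext => u; rewrite erfE.
have dF := is_derive_gauss_tail t.
by apply: is_derive_eq; rewrite subr0.
Qed.

Lemma erf0 : erf 0 = 0 :> R.
Proof. by rewrite erfE subrr mulr0. Qed.

Lemma cvg_erf : @erf R x @[x --> +oo] --> (1 : R).
Proof.
(* The square of the integral over [[0, x]] tends to [pi / 4]; the integral being nonnegative, a
   square root gives its limit. *)
have cvg_sq := @gauss_integral_proof.cvg_integral0_gauss_sqr R.
have cvg_I : @gauss_integral_proof.integral0_gauss R x @[x --> +oo]
    --> Num.sqrt pi / 2.
  have : Num.sqrt (@gauss_integral_proof.integral0_gauss R x ^+ 2)
      @[x --> +oo] --> Num.sqrt (pi / 4 : R).
    by apply: continuous_cvg => //; exact: sqrt_continuous.
  rewrite sqrtrM ?pi_ge0// sqrtrV// (_ : 4 = 2 ^+ 2); last by ring.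
  rewrite sqrtr_sqr ger0_norm//.
  rewrite (_ : (fun _ => Num.sqrt _) = @gauss_integral_proof.integral0_gauss R)//.
  apply/funext => r; rewrite sqrtr_sqr// ger0_norm//.
  exact: gauss_integral_proof.integral0_gauss_ge0.
have sp0 : Num.sqrt (pi : R) != 0 by rewrite gt_eqF// sqrtr_gt0 pi_gt0.
have -> : (1 : R) = 2 / Num.sqrt pi * (Num.sqrt pi / 2) by field.
have : 2 / Num.sqrt pi * @gauss_integral_proof.integral0_gauss R x @[x --> +oo]
    --> 2 / Num.sqrt pi * (Num.sqrt pi / 2).
  by apply: cvgM => //; exact: cvg_cst.
apply: cvg_trans; apply: near_eq_cvg; near=> x.
rewrite /erf; have -> // : 0 <= x.
by near: x; exact: nbhs_pinfty_ge.
Unshelve. all: by end_near. Qed.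

(** The sum [erf (- x) + erf x] has zero derivative and vanishes at 0. *)
Lemma erfN t : erf (- t) = - erf t.
Proof.
apply/eqP; rewrite -addr_eq0; apply/eqP.
have -> : 0 = erf (- 0) + erf 0 :> R by rewrite oppr0 erf0 addr0.
apply: (@is_derive_0_is_cst R (fun x => erf (- x) + erf x)) => x.
have d1 := is_derive1_comp (is_derive_erf (- x)) (is_deriveN (is_derive_id x 1)).
have d2 := is_derive_erf x.
apply: (is_derive_eq (is_deriveD d1 d2)).
by rewrite sqrrN mulrN1 addNr.
Qed.

(** [erf] is nondecreasing with limit 1 at infinity. *)
Lemma erf_le1 t : erf t <= 1.
Proof.
have erf_ge s : t <= s -> erf t <= erf s.
  move=> ts; apply: (nondecreasing_is_derive (fun x _ => is_derive_erf x) _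
    (lexx t)) => //.
have <- : lim (@erf R x @[x --> +oo]) = 1.
  by apply/cvg_lim => //; exact: cvg_erf.
apply: limr_ge; first by apply/cvg_ex; exists 1; exact: cvg_erf.
by near=> s; apply: erf_ge; near: s; apply: nbhs_pinfty_ge; exact: num_real.
Unshelve. all: by end_near. Qed.

(** [gprim x] is the integral of [exp (- s ^ 2 / 2)] over [[0, x]], which is also
    the derivative of [lambda]. *)
Definition gprim x := Num.sqrt (pi / 2) * erf (x / Num.sqrt 2).

Lemma is_derive_gprim x : is_derive x 1 gprim (expR (- x ^+ 2 / 2)).
Proof.
have d := is_derive1_comp (is_derive_erf ((Num.sqrt 2)^-1 *: x))
  (is_deriveZ (Num.sqrt 2)^-1 (is_derive_id x (1 : R))).
have -> : gprim = Num.sqrt (pi / 2) \*: (@erf R \o ((Num.sqrt 2)^-1 \*: id)).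
  by apply/funext => y; rewrite /gprim mulrC [y / _]mulrC mulrC.
apply: (is_derive_eq (is_deriveZ (Num.sqrt (pi / 2)) d)).
have s20 : Num.sqrt (2 : R) != 0 by rewrite gt_eqF// sqrtr_gt0.
have p0 : Num.sqrt (pi : R) != 0 by rewrite gt_eqF// sqrtr_gt0 pi_gt0.
have s2 : Num.sqrt (2 : R) ^+ 2 = 2 by rewrite sqr_sqrtr.
rewrite sqrtrM ?pi_ge0// sqrtrV// /GRing.scale/=.
rewrite (_ : - (_ * x) ^+ 2 = - x ^+ 2 / 2); last by rewrite -{2}s2; field.
transitivity (2 / Num.sqrt 2 ^+ 2 * expR (- x ^+ 2 / 2)); first by field; rewrite s20 p0.
by rewrite s2 divff// mul1r.
Qed.

Lemma gprim0 : gprim 0 = 0.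
Proof. by rewrite /gprim mul0r erf0 mulr0. Qed.

Lemma gprimN x : gprim (- x) = - gprim x.
Proof. by rewrite /gprim mulNr erfN mulrN. Qed.

Lemma gprim_le x : gprim x <= Num.sqrt (pi / 2).
Proof. by rewrite /gprim ler_piMr ?sqrtr_ge0// erf_le1. Qed.

Lemma cvg_gprim : gprim x @[x --> +oo] --> Num.sqrt (pi / 2 : R).
Proof.
rewrite -[X in _ --> X]mulr1; apply: cvgM; first exact: cvg_cst.
apply: (cvg_comp (fun x => x / Num.sqrt 2) (@erf R) _ cvg_erf).
by apply: gt0_cvgMly; [rewrite invr_gt0 sqrtr_gt0|exact: cvg_id].
Qed.

End erf_theory.

(** * Inequalities for lambda and b_inf *)

Section lambda_theory.
Variable R : realType.
Implicit Types x y s t : R.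
Let e x := expR (- x ^+ 2 / 2).
Let L := @gprim R.
Let l := @lambda R.

Lemma lambdaE x : lambda x = expR (- x ^+ 2 / 2) + x * gprim x.
Proof. by rewrite /lambda /gprim; ring. Qed.

Lemma lambda0 : lambda 0 = 1 :> R.
Proof. by rewrite lambdaE mul0r addr0 expr2 mul0r oppr0 mul0r expR0. Qed.

Lemma lambdaN x : lambda (- x) = lambda x.
Proof. by rewrite !lambdaE gprimN sqrrN mulrNN. Qed.

Lemma is_derive_gaussian x : is_derive x 1 e (- x * e x).
Proof.
have d0 := is_deriveZ (- 2^-1) (is_deriveX 2 (is_derive_id x (1 : R))).
have d := is_derive1_comp (is_derive_expR _) d0.
have -> : e = expR \o ((- 2^-1) \*: (id ^+ 2)).
  by apply/funext => y; rewrite /e/= exprfctE/= scaleNr mulNr mulrC.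
apply: (is_derive_eq d); rewrite exprfctE/= /e.
rewrite (_ : - 2^-1 *: x ^+ 2 = - x ^+ 2 / 2); last by rewrite scaleNr mulNr mulrC.
by rewrite /GRing.scale/= expr1; field.
Qed.

(** The derivative [- x * e x] of the Gaussian term cancels the product of [x] with the derivative
    of [gprim]. *)
Lemma is_derive_lambda x : is_derive x 1 l (gprim x).
Proof.
have d1 := is_derive_gaussian x.
have d2 := is_derive_gprim x.
have -> : l = e + id * L.
  by apply/funext => y; rewrite /l lambdaE.
apply: (is_derive_eq (is_deriveD d1 (is_deriveM (is_derive_id x 1) d2))).
by rewrite /GRing.scale/= /e /L; ring.
Qed.

Lemma gprim_ge0 x : 0 <= x -> 0 <= gprim x.
Proof.
move=> x0; rewrite -(@gprim0 R).
apply: (nondecreasing_is_derive (fun x _ => is_derive_gprim x)) x0 => //.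
Qed.

Lemma lambda_ge1 x : 1 <= lambda x.
Proof.
wlog x0 : x / 0 <= x => [H|].
  by have [/H//|/ltW] := leP 0 x; rewrite -oppr_ge0 => /H; rewrite lambdaN.
rewrite -lambda0.
apply: (nondecreasing_is_derive (fun x _ => is_derive_lambda x)) x0 => //.
exact: gprim_ge0.
Qed.

(** The derivative of [K] below is [e x * J x], and that of [J] is [2 * x * L x]; both functions
    vanish at 0, so their signs propagate. *)
Let J x := x * e x + (x ^+ 2 - 1) * L x.

Let J_ge0 x : 0 <= x -> 0 <= J x.
Proof.
move=> x0.
have <- : J 0 = 0 by rewrite /J /L gprim0; ring.
apply: (@nondecreasing_is_derive _ J (fun x => 2 * x * L x) 0 _ _ 0 x (lexx 0) x0);
  last by move=> y y0; rewrite mulr_ge0 ?gprim_ge0// mulr_ge0.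
move=> y _; have d1 := is_derive_gaussian y; have d2 := is_derive_gprim y.
have -> : J = id * e + (id ^+ 2 - cst 1) * L by [].
have d3 := is_deriveX 2 (is_derive_id y (1 : R)).
have d4 := is_deriveB d3 (is_derive_cst (1 : R) y 1).
have d5 := is_deriveD (is_deriveM (is_derive_id y 1) d1) (is_deriveM d4 d2).
apply: (is_derive_eq d5).
rewrite -[(_ - cst 1) y]/(y ^+ 2 - 1) /GRing.scale/= /L /e/=; ring.
Qed.

(** Numerator of the derivative [2 * K x / x ^+ 3] of [(l x ^+ 2 - 1) / x ^+ 2]. *)
Let K x := x * l x * L x - l x ^+ 2 + 1.

Let K_ge0 x : 0 <= x -> 0 <= K x.
Proof.
move=> x0.
have <- : K 0 = 0 by rewrite /K /L gprim0 /l lambda0; ring.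
apply: (@nondecreasing_is_derive _ K (fun x => e x * J x) 0 _ _ 0 x (lexx 0) x0);
  last by move=> y y0; rewrite mulr_ge0 ?J_ge0// expR_ge0.
move=> y _; have d1 := is_derive_lambda y; have d2 := is_derive_gprim y.
have -> : K = id * l * L - l ^+ 2 + cst 1 by [].
have d3 := is_deriveM (is_deriveM (is_derive_id y 1) d1) d2.
have d4 := is_deriveD (is_deriveB d3 (is_deriveX 2 d1)) (is_derive_cst (1 : R) y 1).
apply: (is_derive_eq d4).
rewrite -[(id * l) y]/(y * l y).
by rewrite /GRing.scale/= /J /L /l lambdaE /e/=; ring.
Qed.

Lemma lambda_sqr_ratio_le x y : 0 < x -> x <= y ->
  (lambda x ^+ 2 - 1) / x ^+ 2 <= (lambda y ^+ 2 - 1) / y ^+ 2.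
Proof.
move=> x0 xy.
(* The half-line starts at the given [x > 0], away from the pole at 0. *)
apply: (@nondecreasing_is_derive _ (fun x => (l x ^+ 2 - 1) / x ^+ 2)
  (fun x => 2 * K x / x ^+ 3) x _ _ x y (lexx x) xy) => z xz;
  have z0 := lt_le_trans x0 xz.
- have z20 : z ^+ 2 != 0 by rewrite expf_neq0// gt_eqF.
  have d1 := is_derive_lambda z.
  have d3 := @is_deriveV R (id ^+ 2) z _ 1 z20 (is_deriveX 2 (is_derive_id z (1 : R))).
  have d4 := is_deriveM (is_deriveB (is_deriveX 2 d1) (is_derive_cst (1 : R) z 1)) d3.
  apply: (is_derive_eq d4); rewrite /GRing.scale/= /K /L.
  rewrite -[(_ - cst 1) z]/(l z ^+ 2 - 1) -[(id ^+ 2) z]/(z ^+ 2).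
  by field; rewrite gt_eqF.
- by rewrite divr_ge0 ?mulr_ge0 ?K_ge0 ?exprn_ge0 ?ltW.
Qed.

(** The Gaussian term is at most 1 and [gprim] at most its limit. The slope is that of [lambda] at
    infinity, whence the sharp constant [pi / 2] below. *)
Lemma lambda_le_affine x : 0 <= x -> lambda x <= 1 + x * Num.sqrt (pi / 2).
Proof.
move=> x0; rewrite lambdaE lerD ?ler_wpM2l ?gprim_le//.
by rewrite expR_le1 mulNr oppr_le0 divr_ge0 ?sqr_ge0.
Qed.

(** [pi / 2] is the limit at infinity of the nondecreasing ratio of
    [lambda_sqr_ratio_le]. *)
Lemma lambda_sqr_le_pi x : lambda x ^+ 2 <= 1 + pi / 2 * x ^+ 2.
Proof.
wlog x0 : x / 0 < x => [H|].
  have [/H//|x0|<-] := ltgtP 0 x.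
    by have := H (- x); rewrite oppr_gt0 lambdaN sqrrN; exact.
  by rewrite lambda0 expr1n expr2 !mul0r mulr0 addr0.
rewrite -lerBlDl -ler_pdivrMr ?exprn_gt0//.
pose k := Num.sqrt (pi / 2 : R).
have k2 : k ^+ 2 = pi / 2 by rewrite sqr_sqrtr// divr_ge0 ?pi_ge0.
have k0 : 0 <= k by exact: sqrtr_ge0.
apply/ler_addgt0Pr => d d0; rewrite -k2.
(* So far out, the affine bound gives a ratio of at most [k ^+ 2 + 2 * k / y], which is at most
   [k ^+ 2 + d]. *)
pose y := x + 2 * k / d.
have dk0 : 0 <= 2 * k / d by rewrite divr_ge0 ?mulr_ge0// ltW.
have xy : x <= y by rewrite lerDl.
have y0 := lt_le_trans x0 xy.
apply: (le_trans (lambda_sqr_ratio_le x0 xy)).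
rewrite ler_pdivrMr ?exprn_gt0// lerBlDr.
have ly : lambda y ^+ 2 <= (1 + y * k) ^+ 2.
  rewrite lerXn2r ?nnegrE ?lambda_le_affine ?ltW//.
    exact: lt_le_trans (lambda_ge1 y).
  by rewrite ltr_pwDl// mulr_ge0// ltW.
apply: (le_trans ly).
have : 2 * k <= d * y.
  by rewrite [d * y]mulrC -ler_pdivrMr// /y lerDr ltW.
move=> H; have : 2 * k * y <= d * y * y by rewrite ler_wpM2r// ltW.
rewrite -subr_ge0 => H2; rewrite -subr_ge0.
by rewrite [leRHS](_ : _ = d * y * y - 2 * k * y)//; ring.
Qed.

(** With [x = |c|] and [y = <u, c> / |u|], the right-hand side is [|T_c u|^2 / |u|^2]. By evenness
    [y] may be taken nonnegative, and the ratio at [y] is at most that at [x]. *)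
Lemma lambda_sqr_le_interp x y : `|y| <= x ->
  lambda y ^+ 2 <= 1 + (lambda x ^+ 2 - 1) * (y / x) ^+ 2.
Proof.
wlog y0 : y / 0 <= y => [H|].
  have [/H//|/ltW] := leP 0 y; rewrite -oppr_ge0 => /H.
  by rewrite normrN lambdaN mulNr sqrrN.
rewrite ger0_norm// => yx.
move: y0; rewrite le_eqVlt => /predU1P[<-|y0].
  by rewrite lambda0 expr1n mul0r expr0n mulr0 addr0.
have := lambda_sqr_ratio_le y0 yx.
rewrite ler_pdivrMr ?exprn_gt0// lerBlDl => /le_trans; apply.
by rewrite lerD2l expr_div_n mulrAC -mulrA.
Qed.

Lemma lambda_sqr_interp_le_pi x y : `|y| <= x ->
  1 + (lambda x ^+ 2 - 1) * (y / x) ^+ 2 <= 1 + pi / 2 * y ^+ 2.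
Proof.
move=> yx; rewrite lerD2l.
have : 0 <= x by exact: le_trans yx.
rewrite le_eqVlt => /predU1P[<-|x0].
  by rewrite lambda0 expr1n subrr mul0r mulr_ge0 ?sqr_ge0// divr_ge0 ?pi_ge0.
rewrite expr_div_n mulrCA mulrC ler_wpM2r ?sqr_ge0// ler_pdivrMr ?exprn_gt0//.
by rewrite lerBlDl lambda_sqr_le_pi.
Qed.

(** [phi_inf] is the perspective (degree-one homogenization) of [lambda], with abscissa rescaled by
    [sqrt (2 / pi)]. *)
Lemma phi_infE x s : 0 < s -> phi_inf x s = s * lambda (x * Num.sqrt (2 / pi) / s).
Proof.
move=> s0; rewrite /phi_inf gt_eqF// gtr0_norm// /lambda mulrDr.
have p0 : (0 : R) < pi := pi_gt0 R.
have sp : Num.sqrt (pi : R) ^+ 2 = pi by rewrite sqr_sqrtr// ltW.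
have s2 : Num.sqrt (2 : R) ^+ 2 = 2 by rewrite sqr_sqrtr.
have sp0 : Num.sqrt (pi : R) != 0 by rewrite gt_eqF// sqrtr_gt0.
have s20 : Num.sqrt (2 : R) != 0 by rewrite gt_eqF// sqrtr_gt0.
have ss0 : s != 0 by rewrite gt_eqF.
rewrite !sqrtrM ?ltW// !sqrtrV// ?ltW//.
move: (Num.sqrt 2) (Num.sqrt pi) s2 sp s20 sp0 => q p s2 sp s20 sp0.
congr (_ * expR _ + _).
  by rewrite -sp -s2; field; rewrite ss0 s20 sp0.
rewrite (_ : x * _ / _ / _ = x / (p * s)).
  by field; rewrite s20 ss0 sp0.
by field; rewrite s20 sp0 ss0.
Qed.

Lemma phi_inf_ge0 x s : 0 <= phi_inf x s.
Proof.
have H z : 0 < z -> 0 <= phi_inf x z.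
  move=> z0; rewrite phi_infE// mulr_ge0 ?ltW//.
  exact: lt_le_trans (lambda_ge1 _).
have [s0|s0|->] := ltgtP s 0; last by rewrite /phi_inf eqxx.
  have := H (- s); rewrite oppr_gt0 => /(_ s0).
  by rewrite /phi_inf oppr_eq0 normrN sqrrN.
exact: H.
Qed.

Let phis := [set @phi_inf R (cos t) (sin t) | t in `[0, pi *+ 2]].

(** Lets inequalities be multiplied by [b_inf]. *)
Lemma b_inf_ge0 : 0 <= b_inf R.
Proof.
apply: lb_le_inf; last by move=> _ [t _ <-]; exact: phi_inf_ge0.
exists (phi_inf (cos 0) (sin 0)); exists 0 => //.
by rewrite /= in_itv/= lexx mulrn_wge0// pi_ge0.
Qed.

Lemma b_inf_le x y : x ^+ 2 + y ^+ 2 = 1 -> 0 <= y -> b_inf R <= phi_inf x y.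
Proof.
move=> xy y0; apply: ge_inf.
  (* The infimum bounds the values from below only once the set is known to be bounded below. *)
  by exists 0 => _ [t _ <-]; exact: phi_inf_ge0.
have x1 : -1 <= x <= 1.
  rewrite -ler_norml -(@ler_pXn2r _ 2)// ?nnegrE// expr1n real_normK ?num_real//.
  by rewrite -xy lerDl sqr_ge0.
exists (acos x).
  rewrite /= in_itv/= acos_ge0//=; apply: (le_trans (acos_lepi x1)).
  by rewrite mulr2n lerDl pi_ge0.
rewrite acosK ?in_itv//= sin_acos//; congr phi_inf.
by rewrite -xy [_ + y ^+ 2]addrC addrK sqrtr_sqr ger0_norm.
Qed.

Lemma b_inf_lambda x : b_inf R * Num.sqrt (1 + pi / 2 * x ^+ 2) <= lambda x.
Proof.
set n := Num.sqrt _; pose k := Num.sqrt (pi / 2 : R).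
have p0 : (0 : R) < pi := pi_gt0 R.
have k2 : k ^+ 2 = pi / 2 by rewrite sqr_sqrtr// divr_ge0 ?pi_ge0.
have n2 : n ^+ 2 = 1 + k ^+ 2 * x ^+ 2.
  by rewrite k2 sqr_sqrtr// addr_ge0// mulr_ge0 ?sqr_ge0 ?divr_ge0 ?pi_ge0.
have k0 : 0 < k by rewrite sqrtr_gt0 divr_gt0.
have n0 : 0 < n.
  by rewrite sqrtr_gt0 ltr_pwDl// mulr_ge0 ?sqr_ge0 ?divr_ge0 ?pi_ge0.
rewrite -ler_pdivlMr//.
(* The point [(k * x / n, 1 / n)] lies on the upper unit half circle, because
   [n ^+ 2 = 1 + k ^+ 2 * x ^+ 2]. *)
have -> : lambda x / n = phi_inf (k * x / n) n^-1.
  rewrite phi_infE ?invr_gt0// mulrC; congr (_ * lambda _).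
  have -> : Num.sqrt (2 / pi : R) = k^-1 by rewrite -sqrtrV ?invf_div// divr_ge0 ?pi_ge0.
  by field; rewrite !gt_eqF.
apply: b_inf_le; last by rewrite invr_ge0 ltW.
rewrite !expr_div_n exprMn exprVn -[X in _ + X]mul1r -mulrDl addrC -n2.
by rewrite divff// expf_neq0// gt_eqF.
Qed.

End lambda_theory.

(** * Gaussian integrals *)

Section gaussian_integrals.
Variable R : realType.
Implicit Types (x y t m s p q : R) (h : R -> R).
Let mu := @lebesgue_measure R.
Local Notation N := (@normal_prob R 0 1).

(** Change of variables holds for the Radon-Nikodym derivative, which equals the density almost
    everywhere since both have the same integral over every measurable set. *)
Lemma integral_normal_prob m s (f : R -> \bar R) :
  measurable_fun setT f -> (forall x, 0 <= f x)%E ->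
  (\int[normal_prob m s]_x f x = \int[mu]_x (f x * (normal_pdf m s x)%:E))%E.
Proof.
move=> mf f0.
have dom := normal_prob_dominates m s.
rewrite -(Radon_Nikodym_SigmaFinite.change_of_variables dom f0 measurableT mf).
have mpdf : measurable_fun setT (fun x => (normal_pdf m s x)%:E).
  by apply/measurable_EFinP; exact: measurable_normal_pdf.
have mRN := Radon_Nikodym_SigmaFinite.f_integrable dom.
apply: ae_eq_integral => //.
- by apply: emeasurable_funM => //; exact: (measurable_int _ mRN).
- exact: emeasurable_funM.
- have ae := integral_ae_eq measurableT mRN mpdf (fun E _ mE =>
    esym (Radon_Nikodym_SigmaFinite.f_integral dom mE)).
  by apply: filterS ae => x /= /[apply] ->.
Qed.

Lemma ge0_integral_opp (f : R -> \bar R) :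
  measurable_fun setT f -> (forall x, 0 <= f x)%E ->
  (\int[mu]_x f (- x)%R = \int[mu]_x f x)%E.
Proof.
move=> mf f0.
have mN : measurable_fun setT (-%R : R -> measurableTypeR R) by exact: oppr_measurable.
transitivity (\int[pushforward mu (-%R : R -> measurableTypeR R)]_x f x)%E.
  by rewrite ge0_integral_pushforward.
by apply: eq_measure_integral => //= A mA _; exact: lebesgue_measureN.
Qed.

Lemma ge0_integral_sym (f : R -> R) : continuous f -> (forall x, 0 <= f x) ->
  (\int[mu]_x (f x)%:E = \int[mu]_(x in `[0%R, +oo[) (f x + f (- x))%R%:E)%E.
Proof.
move=> cf f0.
have mf : measurable_fun setT f by exact: continuous_measurable_fun.
have mfN : measurable_fun setT (fun x => f (- x)).
  by apply: (measurableT_comp mf); exact: oppr_measurable.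
have mEf : measurable_fun setT (EFin \o f) by exact/measurable_EFinP.
have mEfN : measurable_fun setT (EFin \o (fun x => f (- x))) by exact/measurable_EFinP.
under [RHS]eq_integral do rewrite EFinD.
rewrite [RHS]ge0_integralD//=; last 4 first.
- by move=> x _; rewrite lee_fin.
- exact: measurable_funTS.
- by move=> x _; rewrite lee_fin.
- exact: measurable_funTS.
rewrite [X in (_ + X)%E](ge0_integration_by_substitution0 mEfN)/=; last first.
  by move=> x; rewrite lee_fin.
under [X in (_ + X)%E]eq_integral do rewrite opprK.
(* Dropping the null endpoint 0 from the positive half makes the two halves disjoint. *)
rewrite -integral_itv_obnd_cbnd; last exact: measurable_funTS.
rewrite -ge0_integral_setU//=.
- by rewrite setUC -setCitvl setUv.
- exact: measurable_funTS.
- by move=> x _; rewrite lee_fin.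
- rewrite disj_set2E; apply/eqP; rewrite -subset0 => x []/= /[!in_itv]/=.
  by rewrite andbT => x0; rewrite leNgt x0.
Qed.

Lemma normal_pdfN01 x : normal_pdf 0 1 (- x) = normal_pdf 0 1 x :> R.
Proof. by rewrite !normal_pdfE ?oner_eq0// /normal_fun !subr0 sqrrN. Qed.

Lemma integral_normal_opp h : continuous h -> (forall x, 0 <= h x) ->
  (\int[N]_x (h (- x))%R%:E = \int[N]_x (h x)%:E)%E.
Proof.
move=> ch h0.
have mh : measurable_fun setT h by exact: continuous_measurable_fun.
have mhN : measurable_fun setT (fun x => h (- x)).
  by apply: (measurableT_comp mh); exact: oppr_measurable.
have pdfE (f : R -> R) : measurable_fun setT f -> (forall x, 0 <= f x) ->
    (\int[N]_x (f x)%:E = \int[mu]_x (f x * normal_pdf 0 1 x)%R%:E)%E.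
  by move=> mf f0; rewrite integral_normal_prob//; exact/measurable_EFinP.
rewrite !pdfE// -[RHS]ge0_integral_opp.
- by under [RHS]eq_integral do rewrite normal_pdfN01.
- by apply/measurable_EFinP; apply: measurable_funM => //; exact: measurable_normal_pdf.
- by move=> x; rewrite lee_fin mulr_ge0 ?normal_pdf_ge0.
Qed.

(** If [X] is standard normal, [m + q X] has density [normal_pdf m q]: substitute the inverse affine
    map [F]. *)
Lemma integral_normal_affine h m q : 0 < q -> continuous h -> (forall x, 0 <= h x) ->
  (\int[N]_x (h (m + q * x))%R%:E = \int[mu]_x (h x * normal_pdf m q x)%R%:E)%E.
Proof.
move=> q0 ch h0.
have qn0 : q != 0 by rewrite gt_eqF.
have chq : continuous (fun x => h (m + q * x)).
  move=> x; apply: (@continuous_comp _ _ _ (fun x => m + q * x) h); last exact: ch.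
  apply: cvgD; first exact: cvg_cst.
  by apply: cvgM; [exact: cvg_cst|exact: cvg_id].
have cG : continuous (fun x => h (m + q * x) * normal_pdf 0 1 x).
  by move=> x; apply: cvgM; [exact: chq|exact: continuous_normal_pdf (oner_neq0 _) _].
rewrite integral_normal_prob; last 2 first.
- by apply/measurable_EFinP; exact: continuous_measurable_fun.
- by move=> x; rewrite lee_fin.
under eq_integral do rewrite -EFinM.
pose F x := q^-1 * (x - m).
have dF (x : R) : is_derive x 1 F q^-1.
  have := is_deriveZ q^-1 (is_deriveB (is_derive_id x (1 : R)) (is_derive_cst m x 1)).
  by move=> d; apply: (is_derive_eq d); rewrite subr0 /GRing.scale/= mulr1.
have F'E : F^`()%classic = cst q^-1.
  by apply/funext => x; rewrite derive1E; have := dF x => ?; rewrite derive_val.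
rewrite (@increasing_ge0_integration_by_substitutionT _ F).
- apply: eq_integral => x _; congr EFin; rewrite F'E /=.
  rewrite -[((_ \o F) * _) x]/(h (m + q * F x) * normal_pdf 0 1 (F x) * q^-1).
  rewrite -mulrA; congr (h _ * _); first by rewrite /F; field.
  rewrite !normal_pdfE ?oner_eq0// /normal_peak /normal_fun subr0 mulrAC.
  congr (_ * expR _); last by rewrite /F; field.
  have p2 : 0 <= pi *+ 2 :> R by rewrite mulrn_wge0 ?pi_ge0.
  rewrite -2!mulrnAr expr1n mul1r sqrtrM ?sqr_ge0// sqrtr_sqr gtr0_norm//.
  by rewrite invfM mulrC.
- by move=> x y xy; rewrite /F ltr_pM2l ?invr_gt0// ltrD2r.
- by rewrite F'E => x; exact: cst_continuous.
- by rewrite F'E; exact: is_cvg_cst.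
- by rewrite F'E; exact: is_cvg_cst.
- by move=> x; have := dF x => ?; exact: ex_derive.
- apply: gt0_cvgMrNy; first by rewrite invr_gt0.
  exact: cvg_addrr_Ny.
- apply: gt0_cvgMry; first by rewrite invr_gt0.
  exact: cvg_addrr.
- exact: cG.
- by move=> x; rewrite mulr_ge0 ?normal_pdf_ge0.
Qed.

(** Completion of the square in [x]; the second factor on the right integrates to
    1 over [x]. *)
Lemma normal_pdf_swap p q s x y : 0 < q -> 0 < s -> s ^+ 2 = p ^+ 2 + q ^+ 2 ->
  normal_pdf (p * x) q y * normal_pdf 0 1 x =
  normal_pdf 0 s y * normal_pdf (p * y / s ^+ 2) (q / s) x.
Proof.
move=> q0 s0 sE.
have qn0 : q != 0 by rewrite gt_eqF.
have sn0 : s != 0 by rewrite gt_eqF.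
have qsn0 : q / s != 0 by rewrite gt_eqF// divr_gt0.
rewrite !normal_pdfE ?oner_eq0// /normal_peak /normal_fun !subr0.
rewrite mulrACA [RHS]mulrACA -!expRD; congr (_ * expR _).
  have sqrtE a : 0 < a -> Num.sqrt (a ^+ 2 * pi *+ 2 : R) = a * Num.sqrt (pi *+ 2).
    by move=> a0; rewrite -mulrnAr sqrtrM ?sqr_ge0// sqrtr_sqr gtr0_norm.
  have p2 : 0 < pi *+ 2 :> R by rewrite mulrn_wgt0 ?pi_gt0.
  rewrite !sqrtE ?divr_gt0//.
  have r0 : Num.sqrt (pi *+ 2 : R) != 0 by rewrite gt_eqF// sqrtr_gt0.
  by field; rewrite r0 sn0 qn0.
(* The difference of the exponents is a multiple of [s ^+ 2 - (p ^+ 2 + q ^+ 2)]. *)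
apply/eqP; rewrite -subr_eq0; apply/eqP.
transitivity ((s ^+ 2 - (p ^+ 2 + q ^+ 2)) *
    ((x ^+ 2 / q ^+ 2 - y ^+ 2 / (q ^+ 2 * s ^+ 2)) / 2)).
  by field; rewrite sn0 qn0.
by rewrite sE subrr mul0r.
Qed.

(** Sum of independent centred Gaussians: write the inner integral with the density of mean [p * x],
    exchange integrals by Tonelli, then use [normal_pdf_swap] to integrate [x] out. *)
Lemma integral_normal_conv h p q : 0 < q -> continuous h -> (forall x, 0 <= h x) ->
  (\int[N]_x \int[N]_y (h (p * x + q * y))%R%:E =
   \int[N]_y (h (Num.sqrt (p ^+ 2 + q ^+ 2) * y))%R%:E)%E.
Proof.
move=> q0 ch h0; set s := Num.sqrt _.
have s0 : 0 < s by rewrite sqrtr_gt0 ltr_wpDl ?sqr_ge0// exprn_gt0.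
have sE : s ^+ 2 = p ^+ 2 + q ^+ 2 by rewrite sqr_sqrtr// addr_ge0 ?sqr_ge0.
have mh : measurable_fun setT h by exact: continuous_measurable_fun.
under eq_integral do rewrite integral_normal_affine//.
pose f (z : measurableTypeR R * measurableTypeR R) :=
  (h z.2 * normal_pdf (p * z.1) q z.2)%:E.
have f0 z : (0 <= f z)%E by rewrite lee_fin mulr_ge0 ?normal_pdf_ge0.
have mf : measurable_fun setT f.
  apply/measurable_EFinP; apply: measurable_funM.
    exact: measurableT_comp.
  rewrite (_ : (fun _ => _) = fun z : measurableTypeR R * measurableTypeR R =>
     normal_peak q * expR (- (z.2 - p * z.1) ^+ 2 / (q ^+ 2 *+ 2))); last first.
    by apply/funext => z; rewrite normal_pdfE ?gt_eqF.
  apply: measurable_funM => //; apply: measurableT_comp => //.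
  apply: measurable_funM => //; apply: measurableT_comp => //.
  apply: measurable_funX; apply: measurable_funB => //.
  exact: measurable_funM.
transitivity (\int[mu]_y \int[N]_x f (x, y))%E.
  exact: fubini_tonelli.
under [in RHS]eq_integral do rewrite -[s * _]add0r.
rewrite [RHS]integral_normal_affine//.
apply: eq_integral => y _.
have m1 : measurable_fun setT (fun x => (h y * normal_pdf (p * x) q y)%:E).
  exact: (measurableT_comp mf (pair2_measurable y)).
rewrite integral_normal_prob//.
transitivity (\int[mu]_x ((h y * normal_pdf 0 s y)%R%:E *
   (normal_pdf (p * y / s ^+ 2)%R (q / s)%R x)%:E))%E.
  apply: eq_integral => x _; rewrite /f /= -!EFinM -[_ * normal_pdf 0 1 x]mulrA.
  by rewrite (@normal_pdf_swap p q s)// mulrA.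
rewrite (@ge0_integralZl _ _ _ mu _ measurableT
  (fun x => (normal_pdf (p * y / s ^+ 2) (q / s) x)%:E))//.
- by rewrite integral_normal_pdf mule1.
- by apply/measurable_EFinP; exact: measurable_normal_pdf.
- by move=> x _; rewrite lee_fin normal_pdf_ge0.
- by rewrite lee_fin mulr_ge0 ?normal_pdf_ge0.
Qed.

End gaussian_integrals.

(** * Euclidean inner product and norm *)

Section euclidean.
Variables (R : realType) (m : nat).
Implicit Types (u v x y c : 'rV[R]_m) (a : R).

Lemma normv_ge0 u : 0 <= normv u.
Proof. exact: sqrtr_ge0. Qed.

Lemma dotvv_ge0 u : 0 <= dotv u u.
Proof. by apply: sumr_ge0 => i _; exact: sqr_ge0. Qed.

Lemma sqr_normv u : normv u ^+ 2 = dotv u u.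
Proof. by rewrite sqr_sqrtr// dotvv_ge0. Qed.

Lemma dotvC u v : dotv u v = dotv v u.
Proof. by apply: eq_bigr => i _; rewrite mulrC. Qed.

Lemma dotvDr u x y : dotv u (x + y) = dotv u x + dotv u y.
Proof.
by rewrite /dotv -big_split; apply: eq_bigr => i _; rewrite mxE mulrDr.
Qed.

Lemma dotvZr a u v : dotv u (a *: v) = a * dotv u v.
Proof. by rewrite /dotv mulr_sumr; apply: eq_bigr => i _; rewrite mxE mulrCA. Qed.

Lemma dotvDl u v x : dotv (u + v) x = dotv u x + dotv v x.
Proof. by rewrite dotvC dotvDr !(dotvC x). Qed.

Lemma dotvZl a u v : dotv (a *: u) v = a * dotv u v.
Proof. by rewrite dotvC dotvZr dotvC. Qed.

Lemma normv_eq0 u : (normv u == 0) = (u == 0).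
Proof.
rewrite sqrtr_eq0 -[_ <= 0]andbT -(dotvv_ge0 u) -eq_le.
apply/eqP/eqP => [/psumr_eq0P u0|->]; last first.
  by rewrite /dotv big1// => i _; rewrite mxE mul0r.
apply/rowP => i; rewrite mxE; apply/eqP; rewrite -(sqrf_eq0 (u _ _)); apply/eqP.
by apply: u0 => // j _; exact: sqr_ge0.
Qed.

Lemma ler_normv_dotv u v : `|dotv u v| <= normv u * normv v.
Proof.
have [->|v0] := eqVneq v 0.
  rewrite [dotv _ _]big1 ?normr0 ?mulr_ge0 ?normv_ge0// => i _.
  by rewrite mxE mulr0.
have nv0 : 0 < normv v by rewrite lt_def normv_eq0 v0 normv_ge0.
rewrite -(@ler_pXn2r _ 2)// ?nnegrE ?mulr_ge0 ?normv_ge0//.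
rewrite real_normK ?num_real// exprMn !sqr_normv.
have vv0 : 0 < dotv v v by rewrite -sqr_normv exprn_gt0.
(* Cauchy-Schwarz: this squared norm expands to [<v,v> (<u,u> <v,v> - <u,v>^2)]. *)
have := dotvv_ge0 (dotv v v *: u - dotv u v *: v).
rewrite -scaleNr !(dotvDl, dotvDr, dotvZl, dotvZr) (dotvC v u).
rewrite [X in 0 <= X](_ : _ = dotv v v * (dotv u u * dotv v v - dotv u v ^+ 2)).
  by rewrite pmulr_rge0// subr_ge0.
by ring.
Qed.

End euclidean.

(** * Support function of G(c) *)

Section absolute_moment.
Variable R : realType.
Implicit Types (x y t s a : R).
Let mu := @lebesgue_measure R.
Local Notation N := (@normal_prob R 0 1).
Let r : R := (Num.sqrt (pi *+ 2))^-1.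
Let e x := expR (- x ^+ 2 / 2).

Lemma normal_pdf1E t x : normal_pdf t 1 x = r * e (x - t).
Proof.
by rewrite normal_pdfE ?oner_eq0// /normal_peak /normal_fun expr1n mul1r.
Qed.

Lemma cvg_gaussian : e x @[x --> +oo] --> (0 : R).
Proof.
have -> : e = (fun x => expR (- x)) \o (fun x => x ^+ 2 / 2).
  by apply/funext => x; rewrite /e/= mulNr.
apply: (cvg_comp _ _ _ (@cvgr_expR R)).
by apply: gt0_cvgMly; [rewrite invr_gt0|exact: cvgr_expr2].
Qed.

Lemma is_derive_shift (f : R -> R) df t x :
  is_derive (x + t) 1 f df -> is_derive x 1 (fun y => f (y + t)) df.
Proof.
move=> f'; have d := is_deriveD (is_derive_id x (1 : R)) (is_derive_cst t x 1).
have := @is_derive1_comp R f (id + cst t) x df (1 + 0) f' d.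
by rewrite addr0 mulr1.
Qed.

(** Mean of a folded normal variable: folding the line at 0 leaves an integral over a half-line with
    an explicit primitive. *)
Lemma integral_abs_shift_normal t :
  (\int[N]_x (`|t + x|)%:E = (2 * r * lambda t)%:E)%E.
Proof.
have cabs : continuous (fun x : R => `|x|) by exact: norm_continuous.
under eq_integral do rewrite -[X in (_ + X)%R]mul1r.
rewrite (@integral_normal_affine _ (fun x : R => `|x|))//.
rewrite ge0_integral_sym; last 2 first.
- by move=> x; apply: cvgM; [exact: cabs|exact: continuous_normal_pdf (oner_neq0 _) _].
- by move=> x; rewrite mulr_ge0 ?normal_pdf_ge0.
pose f x := r * (x * (e (x - t) + e (x + t))).
(* Primitive of [f], found by writing [x] as [(x - t) + t] in one term and [(x + t) - t] in the
   other. *)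
pose F x := r * ((t * gprim (x - t) - e (x - t)) - (t * gprim (x + t) + e (x + t))).
transitivity (\int[mu]_(x in `[0%R, +oo[) (f x)%:E)%E.
  apply: eq_integral => x; rewrite inE/= in_itv/= andbT => x0; congr EFin.
  rewrite normrN ger0_norm// !normal_pdf1E -opprD [e (- _)]/e sqrrN -/(e _).
  by rewrite /f; ring.
have dF (x : R) : is_derive x 1 F (f x).
  have g1 := is_derive_shift (is_derive_gprim (x - t)).
  have g2 := is_derive_shift (is_derive_gprim (x + t)).
  have e1 := is_derive_shift (is_derive_gaussian (x - t)).
  have e2 := is_derive_shift (is_derive_gaussian (x + t)).
  have d := is_deriveZ r (is_deriveB (is_deriveB (is_deriveZ t g1) e1)
    (is_deriveD (is_deriveZ t g2) e2)).
  apply: (is_derive_eq d); rewrite /f /e /GRing.scale/=; ring.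
rewrite (@ge0_continuous_FTC2y _ f F 0 0).
- rewrite -EFinB; congr EFin; rewrite /F !add0r gprimN lambdaE /e sqrrN; ring.
- by move=> x x0; rewrite /f mulr_ge0// ?invr_ge0// mulr_ge0// addr_ge0// expR_ge0.
- have ce s : continuous (fun x => e (x + s)).
    move=> x; have := is_derive_shift (is_derive_gaussian (x + s)) => ?.
    exact/differentiable_continuous/derivable1_diffP/ex_derive.
  apply: continuous_subspaceT => x.
  apply: cvgM; first exact: cvg_cst.
  by apply: cvgM; [exact: cvg_id|apply: cvgD; exact: ce].
(* The two [gprim] terms have the same limit, so [F] tends to 0 at infinity and the integral is
   [- F 0]. *)
- have -> : 0 = r * ((t * Num.sqrt (pi / 2) - 0) -
      (t * Num.sqrt (pi / 2) + 0)) :> R by ring.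
  have cy s : x + s @[x --> +oo] --> (+oo : set_system R) by exact: cvg_addrr.
  have gy s : t * gprim (x + s) @[x --> +oo] --> t * Num.sqrt (pi / 2).
    by apply: cvgM; [exact: cvg_cst|exact: (cvg_comp _ _ (cy s) (@cvg_gprim R))].
  have ey s : e (x + s) @[x --> +oo] --> 0 by exact: (cvg_comp _ _ (cy s) cvg_gaussian).
  apply: cvgM; first exact: cvg_cst.
  by apply: cvgB; [exact: cvgB (gy _) (ey _)|exact: cvgD (gy _) (ey _)].
- by move=> x _; have := dF x => ?; exact: ex_derive.
- apply: cvg_at_right_filter.
  have := dF 0 => ?; exact/differentiable_continuous/derivable1_diffP/ex_derive.
- by move=> x _; rewrite derive1E; have := dF x => ?; rewrite derive_val.
Qed.

Lemma integral_abs_affine_normal a s : 0 < s ->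
  (\int[N]_x (`|a + s * x|)%:E = (2 * r * (s * lambda (a / s)))%:E)%E.
Proof.
move=> s0.
under eq_integral => x _.
  rewrite (_ : `|a + s * x| = s * `|a / s + x|); last first.
    by rewrite -{2}(gtr0_norm s0) -normrM; congr `|_|; field; rewrite gt_eqF.
  rewrite EFinM; over.
rewrite ge0_integralZl ?lee_fin ?ltW//=; last first.
  apply/measurable_EFinP; apply: continuous_measurable_fun => x.
  apply: (@continuous_comp _ _ _ (fun x : R => a / s + x) Num.norm);
    last exact: norm_continuous.
  by apply: cvgD; [exact: cvg_cst|exact: cvg_id].
by rewrite integral_abs_shift_normal -EFinM mulrCA.
Qed.

(** Merges one coordinate with the norm [q] of the remaining ones. That norm may be 0; then
    [sqrt (p ^+ 2)] is [|p|], and symmetry of the normal law absorbs the sign. *)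
Lemma integral_abs_normal_conv a p q : 0 <= q ->
  (\int[N]_x \int[N]_y (`|a + p * x + q * y|)%:E =
   \int[N]_y (`|a + Num.sqrt (p ^+ 2 + q ^+ 2) * y|)%:E)%E.
Proof.
have cabs b : continuous (fun x : R => `|a + b * x|).
  move=> x; apply: (@continuous_comp _ _ _ (fun x : R => a + b * x) Num.norm);
    last exact: norm_continuous.
  by apply: cvgD; [exact: cvg_cst|apply: cvgM; [exact: cvg_cst|exact: cvg_id]].
rewrite le_eqVlt => /predU1P[<-|q0]; last first.
  under eq_integral do under eq_integral do
    rewrite -addrA -[(_ + _)%R in X in (a + X)%R]mul1r.
  rewrite (integral_normal_conv p q0 (cabs 1) (fun x => normr_ge0 _)).
  by under eq_integral do rewrite mul1r.
rewrite expr0n addr0 sqrtr_sqr.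
transitivity (\int[N]_x (`|a + p * x|)%:E)%E.
  apply: eq_integral => x _.
  under eq_integral do rewrite mul0r addr0.
  by rewrite integral_cst//= probability_setT mule1.
have [p0|p0] := leP 0 p; first by rewrite ger0_norm.
rewrite ltr0_norm// -(integral_normal_opp (cabs (- p)) (fun x => normr_ge0 _)).
by under [RHS]eq_integral do rewrite mulrNN.
Qed.

Lemma dotv_recl m (u : 'rV[R]_m.+1) x (v : 'rV[R]_m) :
  dotv u (row_mx (const_mx x : 'rV[R]_1) v) =
  u ord0 ord0 * x + dotv (\row_i u ord0 (lift ord0 i)) v.
Proof.
rewrite /dotv big_ord_recl; congr (_ * _ + _).
  have -> : ord0 = lshift m ord0 :> 'I_(1 + m) by exact: val_inj.
  transitivity ((const_mx x : 'rV[R]_1) ord0 ord0); last by rewrite mxE.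
  exact: row_mxEl.
apply: eq_bigr => i _; rewrite [in RHS]mxE; congr (_ * _).
have -> : lift ord0 i = rshift 1 i :> 'I_(1 + m) by exact: val_inj.
exact: row_mxEr.
Qed.

(** [<u, xi>] is distributed as [|u|] times a standard normal variable. In the induction the offset
    [a] absorbs the coordinate already fixed. *)
Lemma gaussE_abs_affine m (u : 'rV[R]_m) a :
  gaussE (fun v : 'rV[R]_m => (`|a + dotv u v|)%:E) =
  (\int[N]_x (`|a + normv u * x|)%:E)%E.
Proof.
elim: m u a => [|m IH] u a.
  rewrite /= /normv /dotv !big_ord0 sqrtr0 addr0.
  under eq_integral do rewrite mul0r addr0.
  by rewrite integral_cst//= probability_setT mule1.
rewrite /=; pose w : 'rV[R]_m := \row_i u ord0 (lift ord0 i).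
have -> : normv u = Num.sqrt (u ord0 ord0 ^+ 2 + normv w ^+ 2).
  rewrite sqr_normv /normv /dotv big_ord_recl; congr (Num.sqrt (_ + _)).
  by apply: eq_bigr => i _; rewrite !mxE.
rewrite -integral_abs_normal_conv ?normv_ge0//.
apply: eq_integral => x _; rewrite -IH; congr gaussE; apply/funext => v.
by rewrite dotv_recl addrA.
Qed.

Lemma hGE m (c u : 'rV[R]_m) : 0 < normv u ->
  hG c u = (r * (normv u * lambda (dotv u c / normv u)))%:E.
Proof.
move=> u0; rewrite /hG.
under [X in gaussE X]eq_fun do rewrite dotvDr.
rewrite gaussE_abs_affine integral_abs_affine_normal// -EFinM; congr EFin.
by field.
Qed.

End absolute_moment.

(** * Comparison of support functions *)

Section support.
Variables (R : realType) (m : nat) (c : 'rV[R]_m).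
Implicit Types (u v x y : 'rV[R]_m).
Let r : R := (Num.sqrt (pi *+ 2))^-1.

(** Removes the case split: for [c = 0] the correction is a multiple of [c], hence 0. *)
Lemma TcE u : Tc c u =
  u + ((lambda (normv c) - 1) * dotv u c / normv c ^+ 2) *: c.
Proof.
by rewrite /Tc; case: eqP => // ->; rewrite scaler0 addr0.
Qed.

(** By this symmetry, [T_c (r B)] has support function [r |T_c u|]. *)
Lemma dotv_Tc u v : dotv u (Tc c v) = dotv (Tc c u) v.
Proof.
by rewrite !TcE dotvDl dotvDr dotvZl dotvZr (dotvC c v); congr (_ + _); ring.
Qed.

Lemma Tc_surj y : exists x, Tc c x = y.
Proof.
have [c0|c0] := eqVneq c 0; first by exists y; rewrite /Tc c0 eqxx.
have n0 : normv c != 0 by rewrite normv_eq0.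
have l0 : lambda (normv c) != 0 by rewrite gt_eqF// (lt_le_trans ltr01 (lambda_ge1 _)).
(* The inverse of [T_c] scales the direction of [c] by the inverse of [lambda |c|]. *)
exists (y + (((lambda (normv c))^-1 - 1) * dotv y c / normv c ^+ 2) *: c).
rewrite TcE dotvDl dotvZl -sqr_normv -addrA -scalerDl.
rewrite [X in X *: c](_ : _ = 0) ?scale0r ?addr0//.
by field; rewrite n0 l0.
Qed.

(** Pythagoras: only the component of [u] along [c], of length [|<u, c>| / |c|], is scaled. *)
Lemma normv_Tc u : 0 < normv u -> let s := dotv u c / normv u in
  normv (Tc c u) = normv u *
    Num.sqrt (1 + (lambda (normv c) ^+ 2 - 1) * (s / normv c) ^+ 2).
Proof.
move=> u0 s; rewrite -{1}(gtr0_norm u0) -sqrtr_sqr -sqrtrM ?sqr_ge0//.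
congr Num.sqrt; rewrite TcE !(dotvDl, dotvDr, dotvZl, dotvZr) (dotvC c u).
rewrite -!sqr_normv /s.
have [->|n0] := eqVneq (normv c) 0.
  by rewrite lambda0 expr1n subrr !(mul0r, addr0, mulr1).
by field; rewrite n0 gt_eqF.
Qed.

Lemma normr_dotv_div u : 0 < normv u -> `|dotv u c / normv u| <= normv c.
Proof.
move=> u0; rewrite normrM normfV (gtr0_norm u0) ler_pdivrMr// mulrC.
exact: ler_normv_dotv.
Qed.

Lemma hG_le u : 0 < normv u -> (hG c u <= (r * normv (Tc c u))%:E)%E.
Proof.
move=> u0; have sc := normr_dotv_div u0.
rewrite hGE// lee_fin ler_wpM2l ?invr_ge0// normv_Tc// ler_wpM2l ?normv_ge0//.
set s := _ / _.
have l0 : 0 <= lambda s by exact: le_trans (lambda_ge1 _).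
rewrite -[leLHS](ger0_norm l0) -sqrtr_sqr ler_wsqrtr//.
exact: lambda_sqr_le_interp.
Qed.

Lemma b_inf_le_hG u : 0 < normv u ->
  ((b_inf R * (r * normv (Tc c u)))%:E <= hG c u)%E.
Proof.
move=> u0; have sc := normr_dotv_div u0.
rewrite hGE// lee_fin mulrCA ler_wpM2l ?invr_ge0// normv_Tc// mulrCA.
rewrite ler_wpM2l ?normv_ge0//.
(* Both sides are compared through [b_inf R * sqrt (1 + pi / 2 s^2)], where [s = <u, c> / |u|]. *)
apply: le_trans (b_inf_lambda _); rewrite ler_wpM2l ?b_inf_ge0// ler_wsqrtr//.
exact: lambda_sqr_interp_le_pi.
Qed.

(** Covers [u = 0], which the closed form [hGE] excludes. *)
Lemma hG_ge0 u : (0 <= hG c u)%E.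
Proof.
rewrite /hG; under [X in gaussE X]eq_fun do rewrite dotvDr.
by rewrite gaussE_abs_affine mule_ge0 ?lee_fin// integral_ge0.
Qed.

End support.

(** * From support functions to inclusions *)

Theorem theorem2p10 (R : realType) (m : nat) (c : 'rV[R]_m) :
  let r := (Num.sqrt (pi *+ 2 : R))^-1 in
  [set b_inf R *: Tc c y | y in @ballR R m r] `<=` G c /\
  G c `<=` [set Tc c y | y in @ballR R m r].
Proof.
move=> r; have r0 : 0 <= r by rewrite invr_ge0.
have dotv0 (u v : 'rV[R]_m) : normv u = 0 -> dotv u v = 0.
  by move=> u0; apply/eqP; rewrite -normr_le0 -(mul0r (normv v)) -u0 ler_normv_dotv.
split=> [_ [y yr <-] u|x Gx].
  have [u0|] := eqVneq (normv u) 0; first by rewrite dotv0// hG_ge0.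
  move=> u0; have {}u0 : 0 < normv u by rewrite lt_def u0 normv_ge0.
  (* [<u, T_c y> = <T_c u, y>] is at most [r |T_c u|] by Cauchy-Schwarz. *)
  apply: le_trans (b_inf_le_hG c u0).
  rewrite lee_fin dotvZr ler_wpM2l ?b_inf_ge0// dotv_Tc.
  apply: le_trans (ler_norm _) _; apply: le_trans (ler_normv_dotv _ _) _.
  by rewrite mulrC ler_wpM2r ?normv_ge0.
(* With [x = T_c y] and [y = T_c u], the vector [u] is the direction to test: [<u, x> = |y|^2],
   while the bound on [hG] gives [<u, x> <= r |y|], so [|y| > r] is impossible. *)
have [y Ty] := Tc_surj c x; have [u Tu] := Tc_surj c y.
exists y => //=; rewrite /ballR/=.
have [//|ry] := leP (normv y) r.
have y0 := le_lt_trans r0 ry.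
have uxE : dotv u x = normv y ^+ 2 by rewrite -Ty dotv_Tc Tu sqr_normv.
have u0 : 0 < normv u.
  rewrite lt_def normv_ge0 andbT; apply/eqP => /dotv0 => /(_ x).
  by rewrite uxE; apply/eqP; rewrite gt_eqF// exprn_gt0.
have := le_trans (Gx u) (hG_le c u0).
by rewrite uxE Tu lee_fin expr2 ler_pM2r// leNgt ry.
Qed.
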